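(* Let $n\ge 2$ and let $O=\{b_1,\dots,b_m\}$ ($0\le m\le 2n-1$) be an order ideal of the type $(B_n,1)$ poset $Q$ described in the context. An $\oplus$-diagram $D$ of shape $O$ is a $\Gamma$-diagram if and only if for every $k$ with $n<k\le m$ and $D(b_k)=0$, it is not the case that both $D(b_{k-1})=+$ and $D(b_{2n-k+1})=+$ (here $b_{k-1}$ is the box immediately to the left of $b_k$ and $b_{2n-k+1}$ is its conjugate; for $k=n+1$ both are the middle box $b_n$).
   Context: $W$: Weyl group of type $B_n$, simple reflections $s_1,\dots,s_n$ ($s_is_{i+1}$ of order 3 for $i\le n-2$, $s_{n-1}s_n$ of order 4, other pairs commute), Bruhat order $<$. $Q$ is a chain (a single row) $b_1<b_2<\dots<b_{2n-1}$ with labels $s_{b_k}=s_k$ for $k\le n$ and $s_{b_k}=s_{2n-k}$ for $k\ge n$; $b_n$ is the middle box and $b_k$, $b_{2n-k}$ are called conjugate. Order ideals are the initial segments $\{b_1,\dots,b_m\}$. An $\oplus$-diagram of shape $O$ is a map $D:O\to\{0,+\}$. Write $s_{i_t}:=s_{b_{m+1-t}}$ so that $s_{i_1}\cdots s_{i_m}=s_{b_m}\cdots s_{b_1}$, and let $t_t=s_{i_t}$ if $D(b_{m+1-t})=0$, $t_t=1$ if $D(b_{m+1-t})=+$; $v_{(0)}=1$, $v_{(k)}=t_1\cdots t_k$. $D$ is a $\Gamma$-diagram if $v_{(k-1)}<v_{(k-1)}s_{i_k}$ for $k=1,\dots,m$. *)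

(* Defs.v *)
From HB Require Import structures.
From Stdlib Require Import Relation_Operators.
From mathcomp Require Import all_boot all_fingroup.
From mathcomp Require Import cyclic zify.

Set Implicit Arguments.
Unset Strict Implicit.
Unset Printing Implicit Defensive.

Definition refl_group (gT : finGroupType) (I : finType) (s : I -> gT) :
    {set gT} :=
  <<[set s i | i in I]>>%g.

(* Functional in [w]; it has a value [l] exactly when [w] lies in
   [refl_group s]. *)
Definition has_length (gT : finGroupType) (I : finType) (s : I -> gT)
    (w : gT) (l : nat) : Prop :=
  (exists2 r : seq I, size r = l & w = (\prod_(i <- r) s i)%g)
  /\ (forall r : seq I, w = (\prod_(i <- r) s i)%g -> l <= size r).

Definition is_reflection (gT : finGroupType) (I : finType) (s : I -> gT)
    (t : gT) : Prop :=
  exists i : I, exists2 w : gT, w \in refl_group s & t = (s i ^ w)%g.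

Definition bruhat_step (gT : finGroupType) (I : finType) (s : I -> gT)
    (u v : gT) : Prop :=
  exists t : gT, exists lu : nat, exists lv : nat,
    [/\ is_reflection s t, v = (u * t)%g,
        has_length s u lu, has_length s v lv & lu < lv].

Definition bruhat_lt (gT : finGroupType) (I : finType) (s : I -> gT) :
    gT -> gT -> Prop :=
  clos_trans gT (bruhat_step s).

(* The Weyl group of type B_n is refl_group (@simpleB n), the group of signed
   permutations acting on {e_1, -e_1, ..., e_n, -e_n}: the pair (i, false)
   stands for e_(i+1) and (i, true) for -e_(i+1).  The ordinal i : 'I_n indexes
   s_(i+1), the reflection in the root e_(i+1) - e_(i+2) when i + 1 < n, and in
   the root e_n when i + 1 = n (the case where [insub i.+1] is None).
   MathComp composes permutations from left to right; this is immaterial, as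
   the Coxeter relations below do not depend on it. *)
Definition simpleB (n : nat) (i : 'I_n) : {perm 'I_n * bool} :=
  if insub i.+1 is Some j then
    (tperm (i, false) (j, false) * tperm (i, true) (j, true))%g
  else tperm (i, false) (i, true).

Definition bruhatB_lt (n : nat) (u v : {perm 'I_n * bool}) : Prop :=
  bruhat_lt (@simpleB n) u v.

(* The ordinal i : 'I_(2 * n - 1) stands for the box b_(i+1). *)
Definition box (n : nat) := 'I_(2 * n - 1).

Definition boxnum (m : nat) (i : 'I_m) : nat := i.+1.

(* The ordinal of the simple reflection labelling b_k is one less than its
   index, which is k for k <= n and 2n - k for k >= n. *)
Lemma label_subproof (n : nat) (b : box n) :
  (if boxnum b <= n then boxnum b else 2 * n - boxnum b) - 1 < n.
Proof. by rewrite /boxnum; case: b => b /=; case: ifP; lia. Qed.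

Definition label (n : nat) (b : box n) : 'I_n := Ordinal (label_subproof b).

Inductive mark : Type := Zero | Plus.

(* [D i] is the mark in the box b_(i+1) of the order ideal {b_1, ..., b_m}. *)
Definition oplus_diagram (m : nat) := 'I_m -> mark.

(* s_(i_(t+1)) for t : 'I_m, i.e. the label of b_(m-t), whose ordinal is
   [rev_ord t]. *)
Definition word_refl (n m : nat) (hm : m <= 2 * n - 1) (t : 'I_m) :
    {perm 'I_n * bool} :=
  simpleB (label (widen_ord hm (rev_ord t) : box n)).

Definition word_factor (n m : nat) (hm : m <= 2 * n - 1)
    (D : oplus_diagram m) (t : 'I_m) : {perm 'I_n * bool} :=
  if D (rev_ord t) is Zero then word_refl hm t else 1%g.

Definition partial_prod (n m : nat) (hm : m <= 2 * n - 1)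
    (D : oplus_diagram m) (k : nat) : {perm 'I_n * bool} :=
  (\prod_(t < m | t < k) word_factor hm D t)%g.

Definition Gamma_diagram (n m : nat) (hm : m <= 2 * n - 1)
    (D : oplus_diagram m) : Prop :=
  forall k : 'I_m,
    bruhatB_lt (partial_prod hm D k) (partial_prod hm D k * word_refl hm k)%g.

Lemma simpleB_lt (n : nat) (i j : 'I_n) (x : 'I_n) (b : bool) :
  j = i.+1 :> nat -> simpleB i (x, b) = (tperm i j x, b).
Proof.
move=> ij; rewrite /simpleB.
case: insubP => [j' _ j'E|]; last by have := ltn_ord j; lia.
have -> : j' = j by apply/val_inj; exact: etrans j'E (esym ij).
have pair_inj (c : bool) : injective (fun y : 'I_n => (y, c)) by move=> y z [].
have other c y : tperm (i, ~~ c) (j, ~~ c) (y, c) = (y, c).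
  by rewrite tpermD // xpair_eqE; case: c; rewrite andbF.
have same (c : bool) y : tperm (i, c) (j, c) (y, c) = (tperm i j y, c).
  by rewrite -(inj_tperm i j y (@pair_inj c)).
by rewrite permM; case: b; rewrite ?(other true) ?same ?(other false).
Qed.

Lemma simpleB_last (n : nat) (i : 'I_n) (x : 'I_n) (b : bool) :
  i.+1 = n -> simpleB i (x, b) = (x, b (+) (x == i)).
Proof.
move=> ilast; rewrite /simpleB; case: insubP => [j|_]; first by lia.
have [->|xi] := eqVneq x i; first by case: b; rewrite ?tpermL ?tpermR.
by rewrite tpermD ?xpair_eqE ?(eq_sym i) ?(negbTE xi) ?addbF.
Qed.

Lemma simpleB_order (n : nat) (i : 'I_n) : #[simpleB i]%g = 2.
Proof.
have [ilt|ige] := ltnP i.+1 n.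
  pose j := Ordinal ilt; have ij : j = i.+1 :> nat by [].
  apply: nt_prime_order => //.
    apply/permP=> -[x b].
    by rewrite expgS expg1 permM perm1 !(simpleB_lt _ _ ij) tpermK.
  apply/eqP=> /permP/(_ (i, false)); rewrite perm1 (simpleB_lt _ _ ij) tpermL.
  by move=> e; move: (congr1 (fun z => val z.1) e) => /=; lia.
have il : i.+1 = n by have := ltn_ord i; lia.
apply: nt_prime_order => //.
  apply/permP=> -[x b].
  by rewrite expgS expg1 permM perm1 !(simpleB_last _ _ il) addbK.
by apply/eqP=> /permP/(_ (i, false)); rewrite perm1 (simpleB_last _ _ il) eqxx.
Qed.

Lemma simpleB_order3 (n : nat) (i j : 'I_n) :
  j = i.+1 :> nat -> j.+1 < n -> #[simpleB i * simpleB j]%g = 3.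
Proof.
move=> ij jlt; pose k := Ordinal jlt; have jk : k = j.+1 :> nat by [].
have nij : i != j by apply/eqP=> e; move: ij; rewrite e; lia.
have njk : j != k by apply/eqP=> e; move: (congr1 val e) => /=; lia.
have nik : i != k by apply/eqP=> e; move: (congr1 val e) => /=; lia.
have E x b : (simpleB i * simpleB j)%g (x, b) = (tperm j k (tperm i j x), b).
  by rewrite permM (simpleB_lt _ _ ij) (simpleB_lt _ _ jk).
move: (simpleB i * simpleB j)%g E => p E.
have Ei : tperm j k i = i by rewrite tpermD // eq_sym.
have Ek : tperm i j k = k by rewrite tpermD.
apply: nt_prime_order => //.
  apply/permP=> -[x b]; rewrite 2!expgS expg1 !permM perm1 !E.
  congr (_, _); have [->|xi] := eqVneq x i.
    by rewrite !(tpermL, tpermR, Ei, Ek).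
  have [->|xj] := eqVneq x j.
    by rewrite !(tpermL, tpermR, Ei, Ek).
  have [->|xk] := eqVneq x k.
    by rewrite !(tpermL, tpermR, Ei, Ek).
  have D1 : tperm i j x = x by rewrite tpermD // eq_sym.
  have D2 : tperm j k x = x by rewrite tpermD // eq_sym.
  by rewrite !(D1, D2).
apply/eqP=> /permP/(_ (i, false)); rewrite E perm1 !tpermL => e.
by move: (congr1 (fun z => val z.1) e) => /=; lia.
Qed.

Lemma simpleB_order4 (n : nat) (i j : 'I_n) :
  j = i.+1 :> nat -> j.+1 = n -> #[simpleB i * simpleB j]%g = 4.
Proof.
move=> ij jl.
have nij : i != j by apply/eqP=> e; move: ij; rewrite e; lia.
have E x b : (simpleB i * simpleB j)%g (x, b)
           = (tperm i j x, b (+) (tperm i j x == j)).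
  by rewrite permM (simpleB_lt _ _ ij) (simpleB_last _ _ jl).
move: (simpleB i * simpleB j)%g E => p E.
have E2 x b : (p ^+ 2)%g (x, b) = (x, b (+) (x == i) (+) (x == j)).
  rewrite expgS expg1 permM !E tpermK -!addbA; congr (_, _ (+) (_ (+) _)).
  by rewrite -{2}(tpermL i j) (inj_eq perm_inj).
have p4 : (p ^+ 4 = 1)%g.
  apply/permP=> -[x b]; rewrite (expgM p 2 2) expgS expg1 permM !E2 perm1.
  by congr (_, _); case: (x == i); case: (x == j); case: b.
have np2 : (p ^+ 2 != 1)%g.
  apply/eqP=> /permP/(_ (i, false)).
  by rewrite E2 perm1 eqxx (negbTE nij).
have : #[p]%g %| 2 ^ 2 by rewrite order_dvdn p4.
case/(dvdn_pfactor _ _ (isT : prime 2)) => -[|[|[|e]]] // _ ep.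
- by move: np2; rewrite -order_dvdn ep.
- by move: np2; rewrite -order_dvdn ep.
Qed.

Lemma simpleB_comm (n : nat) (i j : 'I_n) :
  i.+1 < j -> commute (simpleB i) (simpleB j).
Proof.
move=> ltij; have i1n : i.+1 < n by have := ltn_ord j; lia.
pose i' := Ordinal i1n; have ii : i' = i.+1 :> nat by [].
have neq (x y : 'I_n) : (x : nat) <> y -> x != y.
  by move=> nxy; apply/eqP=> e; apply: nxy; rewrite e.
have nij : i != j by apply: neq; lia.
have nij' : i' != j by apply: neq => /=; lia.
apply/permP=> -[x b]; rewrite !permM.
have [jlt|jge] := ltnP j.+1 n.
  pose j' := Ordinal jlt; have jj : j' = j.+1 :> nat by [].
  rewrite !(simpleB_lt _ _ ii, simpleB_lt _ _ jj); congr (_, _).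
  rewrite -!permM; congr (fun_of_perm _ x).
  apply/commgP/conjg_fixP; rewrite tpermJ !(@tpermD _ j j') // eq_sym //;
    by apply: neq => /=; lia.
have jl : j.+1 = n by have := ltn_ord j; lia.
rewrite !(simpleB_lt _ _ ii, simpleB_last _ _ jl); congr (_, _ (+) _).
by rewrite -{1}(tpermD nij nij') (inj_eq perm_inj).
Qed.

(* Main.v *)
Require Import Defs.
From Stdlib Require Import Relation_Operators.
From mathcomp Require Import all_boot all_fingroup.
From mathcomp Require Import zify.

(** Order the 2n points as e_1, ..., e_n, -e_n, ..., -e_1 and rank them from 0
    to 2n - 1.  Every simple reflection then exchanges adjacent points (and
    their negatives), the exchange argument shows that v < v s_i if and only if
    v^-1 preserves the order of the adjacent points exchanged by s_i, and the
    successive inverses v_(t)^-1 become arrays of ranks in which each zero of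
    the diagram exchanges two adjacent entries.  On the way from box b_(2n-1)
    to box b_n the labels increase and no comparison fails: one entry is carried
    to the right and leaves [settled z i] behind at index i.  On the way back
    the carried entry is either negative, or the settled entry at the index j of
    the most recent plus met on the way back (b_n included).  A settled entry at
    i < j exceeds the one at j only if the first visit saw a zero at j - 1 and a
    plus at j, which together with the plus at j on the way back is exactly the
    forbidden pattern.  Boxes outside the shape are harmless when filled with +,
    so the shape may be assumed to be the whole chain. *)

Set Implicit Arguments.
Unset Strict Implicit.
Unset Printing Implicit Defensive.

(** * Length and Bruhat order *)

Section Length.

Variables (gT : finGroupType) (I : finType) (s : I -> gT).

Lemma has_length_prod (r : seq I) :
  exists l, has_length s (\prod_(i <- r) s i)%g l.
Proof.
set w := (\prod_(i <- r) s i)%g.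
(* Words of a given length form a finite type, so [P] is decidable and [ex_minn] provides a least
   length. *)
pose P l := [exists t : l.-tuple I, w == (\prod_(i <- t) s i)%g].
have inP (q : seq I) : w = (\prod_(i <- q) s i)%g -> P (size q).
  by move=> wE; apply/existsP; exists (in_tuple q); apply/eqP.
have exP : exists l, P l by exists (size r); apply: inP.
exists (ex_minn exP); case: ex_minnP => l /existsP[t /eqP wt] lmin; split.
  by exists t; rewrite ?size_tuple.
by move=> q /inP /lmin.
Qed.

Lemma has_length_inj w l1 l2 :
  has_length s w l1 -> has_length s w l2 -> l1 = l2.
Proof.
move=> [[r1 <- w1] min1] [[r2 <- w2] min2].
by apply/eqP; rewrite eqn_leq min1 // min2.
Qed.

Lemma bruhat_lt_length u v : bruhat_lt s u v ->
  exists lu lv, [/\ has_length s u lu, has_length s v lv & lu < lv].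
Proof.
elim=> {u v} [u v|u v w _ [lu [lv [hu hv luv]]] _ [lv' [lw [hv' hw lvw]]]].
  by move=> [t [lu [lv [_ _ hu hv luv]]]]; exists lu, lv.
exists lu, lw; split=> //; apply: ltn_trans luv _.
by rewrite (has_length_inj hv hv').
Qed.

Lemma bruhat_lt_mulr r i lu lv :
  let u := (\prod_(j <- r) s j)%g in
  has_length s u lu -> has_length s (u * s i)%g lv -> lu < lv ->
  bruhat_lt s u (u * s i)%g.
Proof.
move=> u hu hv luv; apply: t_step; exists (s i), lu, lv; split=> //.
by exists i; exists 1%g; rewrite ?group1 ?conjg1.
Qed.

End Length.

(** * Signed permutations *)

Definition negB {n} (x : 'I_n * bool) : 'I_n * bool := (x.1, ~~ x.2).

Definition rankB {n} (x : 'I_n * bool) : nat :=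
  if x.2 then 2 * n - 1 - x.1 else x.1.

(** For [i = n - 1] the two exchanged pairs coincide, so one formula covers both kinds of simple
    reflection. *)
Definition swapB (n i r : nat) : nat :=
  if r == i then i.+1 else if r == i.+1 then i
  else if r == 2 * n - 2 - i then 2 * n - 1 - i
  else if r == 2 * n - 1 - i then 2 * n - 2 - i else r.

(** When [y] is the negative of [x], the two transpositions would cancel, hence the separate
    case. *)
Definition reflB {n} (x y : 'I_n * bool) : {perm 'I_n * bool} :=
  if y == negB x then tperm x y
  else (tperm x y * tperm (negB x) (negB y))%g.

(** Despite the names, [low_root] and [high_root] are the two points of adjacent rank exchanged by
    [simpleB i]. *)
Definition low_root {n} (i : 'I_n) : 'I_n * bool := (i, false).

Definition high_root {n} (i : 'I_n) : 'I_n * bool :=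
  if insub i.+1 is Some j then (j, false) else (i, true).

Section SignedPerm.

Variable n : nat.
Implicit Types (x y : 'I_n * bool) (i j : 'I_n) (u : {perm 'I_n * bool}).

Lemma negBK : involutive (@negB n).
Proof. by case=> x b; rewrite /negB /= negbK. Qed.

Lemma rankB_inj : injective (@rankB n).
Proof.
move=> [x b] [y c]; rewrite /rankB /= => e.
have [xy bc] : x = y :> nat /\ b = c.
  by have := ltn_ord x; have := ltn_ord y; case: b c e => -[]; lia.
by rewrite bc; congr (_, _); apply: val_inj.
Qed.

Lemma rankB_neg x : rankB (negB x) = 2 * n - 1 - rankB x.
Proof. by case: x => x []; rewrite /rankB /=; have := ltn_ord x; lia. Qed.

Lemma rankB_lt x : rankB x < 2 * n.
Proof. by case: x => x []; rewrite /rankB /=; have := ltn_ord x; lia. Qed.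

Lemma rankB_low i : rankB (low_root i) = i.
Proof. by []. Qed.

Lemma rankB_high i : rankB (high_root i) = i.+1.
Proof.
rewrite /high_root; case: insubP => [j _ jE|] //.
by rewrite /rankB /=; have := ltn_ord i; lia.
Qed.

Lemma rankB_simpleB i x : rankB (simpleB i x) = swapB n i (rankB x).
Proof.
case: x => x b; have xn := ltn_ord x; have [ilt|ige] := ltnP i.+1 n.
  have ij : Ordinal ilt = i.+1 :> nat by [].
  rewrite (simpleB_lt _ _ ij) /rankB /swapB /=; case: tpermP => [->|->|] /=.
  - by case: b; do ?case: eqP; lia.
  - by case: b; do ?case: eqP; lia.
  move=> /eqP; rewrite -val_eqE /= => xi /eqP; rewrite -val_eqE /= => xj.
  by case: b; do ?case: eqP; lia.
have il : i.+1 = n by have := ltn_ord i; lia.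
rewrite (simpleB_last _ _ il) /rankB /swapB -val_eqE /=.
by case: (nat_of_ord x =P i) => xi; case: b => /=; do ?case: eqP; lia.
Qed.

Lemma swapB_sub i r :
  r < 2 * n -> swapB n i (2 * n - 1 - r) = 2 * n - 1 - swapB n i r.
Proof. by move=> rn; have := ltn_ord i; rewrite /swapB; do ?case: ifP; lia. Qed.

Lemma simpleB_neg i x : simpleB i (negB x) = negB (simpleB i x).
Proof.
apply: rankB_inj; rewrite !(rankB_neg, rankB_simpleB).
by rewrite swapB_sub ?rankB_lt.
Qed.

Lemma simpleB_reflB i : simpleB i = reflB (low_root i) (high_root i).
Proof.
rewrite /simpleB /reflB /low_root /high_root.
by case: insubP => [j _ _|_]; rewrite /negB /= xpair_eqE ?andbF ?eqxx.
Qed.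

Lemma simpleBK i : (simpleB i * simpleB i)%g = 1%g.
Proof. by have := expg_order (simpleB i); rewrite simpleB_order. Qed.

Lemma simpleBV i : (simpleB i)^-1%g = simpleB i.
Proof. by apply/eqP; rewrite eq_invg_mul simpleBK. Qed.

Lemma reflB_sym x y : reflB (negB y) (negB x) = reflB x y.
Proof.
rewrite /reflB !negBK (eq_sym (negB x)).
have [->|nyx] := eqVneq y (negB x); first by rewrite negBK.
rewrite tpermC (tpermC y).
suff: commute (tperm (negB x) (negB y)) (tperm x y) by [].
have neq_neg (w : 'I_n * bool) : negB w != w.
  by case: w => w b; rewrite xpair_eqE /= eqxx; case: b.
have nxy : negB y != x by rewrite (inv_eq negBK).
apply/commgP/conjg_fixP; rewrite tpermJ !tpermD ?(eq_sym x) ?(eq_sym y) //.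
by rewrite eq_sym.
Qed.

Lemma reflBJ u x y : (forall z, u (negB z) = negB (u z)) ->
  (reflB x y ^ u)%g = reflB (u x) (u y).
Proof.
move=> uneg; rewrite /reflB -uneg (inj_eq perm_inj).
by case: ifP => _; rewrite ?conjMg !tpermJ ?uneg.
Qed.

(** A simple reflection reverses only the adjacent pairs that it exchanges. These are negatives of
    each other, so [reflB_sym] gives both the same reflection. *)
Lemma reflB_reversed i x y :
  rankB x < rankB y -> rankB (simpleB i y) < rankB (simpleB i x) ->
  reflB x y = simpleB i.
Proof.
move=> xy; rewrite !rankB_simpleB => yx.
have xn := rankB_lt x; have yn := rankB_lt y; have iltn := ltn_ord i.
have [[xi yi]|[xi yi]] :
    (rankB x = i /\ rankB y = i.+1) \/
    (rankB x = 2 * n - 1 - i.+1 /\ rankB y = 2 * n - 1 - i).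
- by move: yx; rewrite /swapB; do ?case: ifP; lia.
- rewrite simpleB_reflB; congr reflB; apply: rankB_inj.
    by rewrite rankB_low.
  by rewrite rankB_high.
rewrite simpleB_reflB -reflB_sym; congr reflB; apply: rankB_inj.
  by rewrite rankB_neg rankB_low; lia.
by rewrite rankB_neg rankB_high; lia.
Qed.

(** * The exchange condition and the ascent criterion *)

Lemma prodB_neg (r : seq 'I_n) x :
  let v := (\prod_(j <- r) simpleB j)%g in (v^-1)%g (negB x) = negB ((v^-1)%g x).
Proof.
elim: r x => [|i r IH] x /=; first by rewrite big_nil invg1 !perm1.
by rewrite big_cons invMg !permM IH simpleBV simpleB_neg.
Qed.

(** Induction on the word. If the tail [v] already has the descent, a shorter word comes from the
    tail; otherwise the first letter s_j creates it, so [v * s_i * v^-1 = s_j] and s_j can be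
    deleted. *)
Lemma exchangeB (r : seq 'I_n) i :
  let v := (\prod_(j <- r) simpleB j)%g in
  rankB ((v^-1)%g (high_root i)) < rankB ((v^-1)%g (low_root i)) ->
  exists2 r' : seq 'I_n,
    size r' < size r & (v * simpleB i = \prod_(j <- r') simpleB j)%g.
Proof.
elim: r => [|j r IH] /=.
  by rewrite big_nil invg1 !perm1 rankB_low rankB_high ltnNge leqnSn.
rewrite big_cons invMg !permM simpleBV; set v := (\prod_(j <- r) _)%g => desc.
have [/IH[r' sr' vE]|le_v] :=
    ltnP (rankB ((v^-1)%g (high_root i))) (rankB ((v^-1)%g (low_root i))).
  by exists (j :: r') => //; rewrite big_cons -mulgA vE.
exists r => //; rewrite -/v.
have lt_v : rankB ((v^-1)%g (low_root i)) < rankB ((v^-1)%g (high_root i)).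
  rewrite ltn_neqAle le_v andbT; apply/eqP=> /rankB_inj/perm_inj.
  by move/(congr1 rankB); rewrite rankB_low rankB_high; lia.
have := reflB_reversed lt_v desc.
rewrite -reflBJ; last exact: prodB_neg.
rewrite -simpleB_reflB conjgE invgK => <-.
by rewrite -!mulgA mulKg simpleBK mulg1.
Qed.

Lemma length_descentB (r : seq 'I_n) i l l' :
  let v := (\prod_(j <- r) simpleB j)%g in
  rankB ((v^-1)%g (high_root i)) < rankB ((v^-1)%g (low_root i)) ->
  has_length (@simpleB n) v l -> has_length (@simpleB n) (v * simpleB i)%g l' ->
  l' < l.
Proof.
move=> v desc [[q <- vE] _] [_ min'].
move: desc; rewrite vE => /exchangeB[q' sq' qE].
by apply: leq_ltn_trans sq'; apply: min'; rewrite vE.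
Qed.

Lemma simpleB_low i : simpleB i (low_root i) = high_root i.
Proof.
apply: rankB_inj; rewrite rankB_simpleB rankB_low rankB_high /swapB.
by rewrite eqxx.
Qed.

Lemma simpleB_high i : simpleB i (high_root i) = low_root i.
Proof. by rewrite -simpleB_low -permM simpleBK perm1. Qed.

Lemma bruhatB_ltP (r : seq 'I_n) i :
  let v := (\prod_(j <- r) simpleB j)%g in
  bruhatB_lt v (v * simpleB i)%g <->
  rankB ((v^-1)%g (low_root i)) < rankB ((v^-1)%g (high_root i)).
Proof.
move=> v; split=> [/bruhat_lt_length[l [l' [hl hl' ll']]]|asc].
  rewrite ltnNge leq_eqVlt; apply/negP=> /orP[/eqP/rankB_inj/perm_inj|desc].
    by move/(congr1 rankB); rewrite rankB_low rankB_high; lia.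
  by have := length_descentB desc hl hl'; lia.
have [l hl] := has_length_prod (@simpleB n) r.
have vsE : (v * simpleB i)%g = (\prod_(j <- rcons r i) simpleB j)%g.
  by rewrite big_rcons.
have [l' hl'] := has_length_prod (@simpleB n) (rcons r i).
have hl2 := hl'; rewrite -vsE in hl2; apply: (bruhat_lt_mulr hl hl2).
(* An ascent of [v] is a descent of [v * simpleB i], whose product with [simpleB i] is [v] again. *)
apply: (length_descentB (i := i) _ hl').
  rewrite -vsE invMg simpleBV !permM simpleB_low simpleB_high.
  exact: asc.
by rewrite -vsE -mulgA simpleBK mulg1.
Qed.

End SignedPerm.

(** * The array of ranks *)

(* Indices: step t visits the box b_(2n-1-t), and [z t] says that this box
   contains a zero.  The 0-based label i < n is visited at the steps i and
   2n - 2 - i, which coincide for i = n - 1. *)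

Definition step_label (n t : nat) : nat := if t < n then t else 2 * n - 2 - t.

(** Entry [x] is the rank of the image, under the inverse partial product, of the point of rank [x].
    The newest factor of the inverse acts first, so each step permutes indices and not values. *)
Fixpoint rank_array (n : nat) (z : nat -> bool) (t x : nat) : nat :=
  if t is t'.+1 then
    rank_array n z t' (if z t' then swapB n (step_label n t') x else x)
  else x.

(** The entry at index [i] just before step [i] on the way up: the start of the run of zeros ending
    at step [i - 1], or [i] if there is none. *)
Fixpoint carried (z : nat -> bool) (i : nat) : nat :=
  if i is i'.+1 then (if z i' then carried z i' else i) else 0.

Definition settled (z : nat -> bool) (i : nat) : nat :=
  if z i then i.+1 else carried z i.

(** The entry at index [n - 1 - q] after [n + q] steps. A zero in the middle box replaces the
    carried entry by its negative. *)
Fixpoint carried_back (n : nat) (z : nat -> bool) (q : nat) : nat :=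
  if q is q'.+1 then
    (if z (n + q') then carried_back n z q' else settled z (n - 2 - q'))
  else if z n.-1 then 2 * n - 1 - carried z n.-1 else carried z n.-1.

Section RankArray.

Variables (n : nat) (z : nat -> bool).
Hypothesis n_gt1 : 1 < n.

Lemma carried_le i : carried z i <= i.
Proof. by elim: i => //= i IH; case: ifP => _ //; apply: leqW. Qed.

Lemma settled_le i : settled z i <= i.+1.
Proof. by rewrite /settled; case: ifP => // _; apply: leqW (carried_le i). Qed.

Lemma rank_array_id t :
  (forall t', t' < t -> z t' = false) -> rank_array n z t =1 id.
Proof.
by elim: t => [|t IH] zF x //=; rewrite zF // IH // => t' /leqW; apply: zF.
Qed.

(** Every exchange respects negation, so the lower half of the array determines the upper half. *)
Lemma rank_array_sub t x : x < 2 * n -> t < 2 * n ->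
  rank_array n z t (2 * n - 1 - x) = 2 * n - 1 - rank_array n z t x.
Proof.
elim: t x => //= t IH x xn tn.
case: ifP => _; last by rewrite IH //; lia.
have ln : step_label n t < n by rewrite /step_label; case: ifP; lia.
rewrite -[step_label n t]/(val (Ordinal ln)) swapB_sub // IH //; last by lia.
by rewrite /swapB /=; do ?case: ifP; lia.
Qed.

Lemma rank_array_up t x : t < n -> x < n ->
  rank_array n z t x =
  if x < t then settled z x else if x == t then carried z t else x.
Proof.
elim: t x => [|t IH] x tn xn /=; first by case: eqP.
have tn' : t < n by lia.
rewrite /step_label tn' ltnS /settled; case zt: (z t); last first.
  rewrite IH //; case: (ltngtP x t) => [xt|xt|->].
  - by rewrite /settled.
  - by case: eqP.
  - by rewrite zt.
rewrite /swapB; case: (ltngtP x t) => [xt|xt|->].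
- rewrite ltn_eqF ?ltn_eqF; try lia.
  by rewrite IH // xt.
- case: eqP => [xE|nx]; first by rewrite IH // ltnn eqxx.
  rewrite !ltn_eqF; try lia.
  by rewrite IH //; do ?case: ifP; lia.
by rewrite zt IH //; do ?case: ifP; lia.
Qed.

Lemma rank_array_down q : n + q <= 2 * n - 1 ->
  (forall x, x < n - 1 - q -> rank_array n z (n + q) x = settled z x) /\
  rank_array n z (n + q) (n - 1 - q) = carried_back n z q.
Proof.
elim: q => [|q IH] qn.
  case: n n_gt1 rank_array_up rank_array_sub => // k k0 up sub.
  rewrite addn0 /= /step_label ltnSn; split=> [x xk|].
    have -> : (if z k then swapB k.+1 k x else x) = x.
      by case: ifP => // _; rewrite /swapB; do ?case: ifP; lia.
    by rewrite up; [case: ifP; lia | lia | lia].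
  rewrite subn1 subn0 /= /swapB eqxx; case: ifP => _.
    have -> : rank_array k.+1 z k k.+1 = rank_array k.+1 z k (2 * k.+1 - 1 - k).
      by congr rank_array; lia.
    by rewrite sub; [rewrite up ?ltnn ?eqxx // ltnSn | lia | lia].
  by rewrite up ?ltnn ?eqxx.
have [|IHx IHd] := IH; first by lia.
(* Step [n + q] exchanges the indices [n - 2 - q] and [n - 1 - q], so all smaller indices stay
   settled. *)
have lE : step_label n (n + q) = n - 2 - q.
  by rewrite /step_label; case: ifP; lia.
rewrite addnS /= lE; split=> [x xn|].
  rewrite -IHx; last by lia.
  congr rank_array; case: ifP => // _.
  by rewrite /swapB; do ?case: ifP; lia.
have -> : n - 1 - q.+1 = n - 2 - q by lia.
case: ifP => _; last by rewrite IHx //; lia.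
by rewrite /swapB eqxx -IHd; congr rank_array; lia.
Qed.

Lemma carried_back_plus q :
  q < n -> ~~ z (n + q - 1) -> carried_back n z q = settled z (n - 1 - q).
Proof.
case: q => [|q] qn /=.
  by rewrite addn0 subn0 /settled -subn1 => /negbTE ->.
by rewrite addnS subn1 /= => /negbTE ->; congr settled; lia.
Qed.

(** Step [2 * n - 2 - j] is the return visit of label [j], which for [j = n - 1] is the middle step.
    Ranks from [n] on belong to negative points. *)
Lemma carried_back_cases q : q < n ->
  n <= carried_back n z q \/
  exists j, [/\ n - 1 - q <= j, j < n, ~~ z (2 * n - 2 - j)
              & carried_back n z q = settled z j].
Proof.
elim: q => [|q IH] qn /=.
  case zn: (z n.-1).
    by left; have := carried_le n.-1; lia.
  have nE : 2 * n - 2 - n.-1 = n.-1 by lia.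
  right; exists n.-1; rewrite nE zn /settled zn; split=> //; lia.
case zq: (z (n + q)).
  have [|le_n|[j [lej ltj zj dE]]] := IH; first by lia.
    by left.
  by right; exists j; split=> //; lia.
have nE : 2 * n - 2 - (n - 2 - q) = n + q by lia.
right; exists (n - 2 - q); rewrite nE zq; split=> //; lia.
Qed.

(** Always [settled z i <= i.+1 <= j]. A zero at [j] gives [settled z j = j.+1]. Otherwise there is
    a plus at [j.-1], so [settled z j = j], and equality would need [i = j.-1] with a zero there. *)
Lemma settled_lt i j : i < j -> ~~ (z j.-1 && ~~ z j) ->
  settled z i < settled z j.
Proof.
move=> ij; rewrite negb_and negbK /settled => /orP zj.
have := carried_le i; case: ifP zj => [zi|zi] zj ci.
  case: ifP zj => [|zjF]; first by lia.
  case=> // /negbTE zj1; case: j ij zj1 {zjF} => //= j ij zj1.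
  by rewrite zj1; have : i != j by [apply: contraFneq zj1 => <-]; lia.
case: ifP zj => [|zjF]; first by lia.
by case=> // /negbTE; case: j ij {zjF} => //= j ij ->; lia.
Qed.

(** With k = 2n - 1 - i, the steps [i], [i.+1] and [2 * n - 3 - i] visit b_k, b_(k-1) and
    b_(2n-k+1). *)
Lemma rank_array_orderedP :
  (forall t, t < 2 * n - 1 ->
     rank_array n z t (step_label n t) < rank_array n z t (step_label n t).+1)
  <-> (forall i, i.+1 < n -> z i -> ~~ z i.+1 -> z (2 * n - 3 - i)).
Proof.
split=> [ord i lt_in zi zi1|good t tn].
  (* The comparison fails at the return visit of label [i], where the entries are [i.+1] and
     [carried z i <= i]. *)
  apply: contraT => zc; have := ord (2 * n - 2 - i).
  have [q [qE qn]] : exists q, 2 * n - 2 - i = n + q /\ n + q < 2 * n - 1.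
    by exists (n - 2 - i); lia.
  have [|Hx Hd] := @rank_array_down q; first by lia.
  have -> : step_label n (2 * n - 2 - i) = i.
    by rewrite /step_label; case: ifP; lia.
  rewrite qE Hx; last by lia.
  have -> : i.+1 = n - 1 - q by lia.
  rewrite Hd carried_back_plus; try lia; last first.
    by have -> : n + q - 1 = 2 * n - 3 - i by lia.
  have -> : n - 1 - q = i.+1 by lia.
  rewrite /settled zi (negbTE zi1) /= zi => /(_ qn).
  by have := carried_le i; lia.
rewrite /step_label; have [ltn|le_nt] := ltnP t n.
  have [t1|] := ltnP t.+1 n.
    rewrite !rank_array_up //; try lia.
    rewrite ltnn eqxx.
    by have := carried_le t; do ?case: ifP; lia.
  (* At the middle step, index [n] holds the negative of the carried entry. *)
  move=> nt; have -> : t.+1 = 2 * n - 1 - t by lia.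
  rewrite rank_array_sub; try lia.
  rewrite rank_array_up // ltnn eqxx.
  by have := carried_le t; lia.
have [q tE] : exists q, t = n + q by exists (t - n); lia.
have [|Hx Hd] := @rank_array_down q; first by lia.
have -> : (2 * n - 2 - t).+1 = n - 1 - q by lia.
rewrite tE Hd Hx; last by lia.
have [|le_n|[j [lej ltj zj ->]]] := @carried_back_cases q; first by lia.
  by have := settled_le (2 * n - 2 - (n + q)); lia.
apply: settled_lt; first by lia.
apply: contra zj => /andP[zj1 zj]; have j0 : j.-1.+1 = j by lia.
have := good j.-1; rewrite j0 => /(_ ltj zj1 zj).
by have -> : 2 * n - 3 - j.-1 = 2 * n - 2 - j by lia.
Qed.

End RankArray.

(** * Diagrams *)

Definition is_zero (a : mark) : bool := if a is Zero then true else false.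

Lemma is_zeroP a : reflect (a = Zero) (is_zero a).
Proof. by case: a; constructor. Qed.

Lemma is_plusP a : reflect (a = Plus) (~~ is_zero a).
Proof. by case: a; constructor. Qed.

Definition zero_at (n m : nat) (D : oplus_diagram m) (t : nat) : bool :=
  if insub (2 * n - 2 - t) is Some b then is_zero (D b) else false.

Section Diagram.

Variables (n m : nat) (hm : m <= 2 * n - 1) (D : oplus_diagram m).
Hypothesis n_gt1 : 1 < n.

(** Boxes outside the shape take up the first [offset] steps, so factor [k] of the word belongs to
    step [k + offset]. *)
Local Notation offset := (2 * n - 1 - m).

Lemma zero_atE (b : 'I_m) t :
  t <= 2 * n - 2 -> b = 2 * n - 2 - t :> nat -> zero_at n D t = is_zero (D b).
Proof.
move=> tn bE; rewrite /zero_at; case: insubP => [b' _ b'E|].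
  congr (is_zero (D _)); apply: val_inj; exact: etrans b'E (esym bE).
by rewrite -bE ltn_ord.
Qed.

Lemma zero_at_outside t : t < offset -> zero_at n D t = false.
Proof. by rewrite /zero_at; case: insubP => // b ltm _; lia. Qed.

Lemma partial_prod0 : partial_prod hm D 0 = 1%g.
Proof. by rewrite /partial_prod big_pred0. Qed.

Lemma partial_prodS (k : 'I_m) :
  partial_prod hm D k.+1 = (partial_prod hm D k * word_factor hm D k)%g.
Proof.
(* Extending the factors to all naturals turns the filtered product into one over ['I_j], to which
   [big_ord_recr] applies. *)
pose F t := if insub t is Some t' then word_factor hm D t' else 1%g.
have FE (t : 'I_m) : F t = word_factor hm D t by rewrite /F valK.
have E j : j <= m -> partial_prod hm D j = (\prod_(t < j) F t)%g.
  move=> jm; rewrite (big_ord_widen m F jm) /partial_prod.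
  by apply: eq_bigr => t _; rewrite FE.
by rewrite !E ?(ltnW (ltn_ord k)) // big_ord_recr /= FE.
Qed.

Lemma word_label (k : 'I_m) :
  label (widen_ord hm (rev_ord k) : box n) = step_label n (k + offset) :> nat.
Proof.
rewrite /= /boxnum /= /step_label; have := ltn_ord k.
by do ?case: ifP; lia.
Qed.

Lemma word_factorE (k : 'I_m) : word_factor hm D k =
  if zero_at n D (k + offset) then word_refl hm k else 1%g.
Proof.
rewrite (@zero_atE (rev_ord k)) /=; last 2 first.
- by have := ltn_ord k; lia.
- by have := ltn_ord k; lia.
by rewrite /word_factor; case: (D _).
Qed.

Lemma partial_prod_word k : k <= m ->
  exists r, partial_prod hm D k = (\prod_(i <- r) simpleB i)%g.
Proof.
elim: k => [|k IH] km; first by exists [::]; rewrite partial_prod0 big_nil.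
have [r rE] := IH (ltnW km).
rewrite (partial_prodS (Ordinal km)) /= rE /word_factor.
case: (D _); last by exists r; rewrite mulg1.
by eexists (rcons r _); rewrite big_rcons.
Qed.

Lemma rankB_partial_prod k x : k <= m ->
  rankB ((partial_prod hm D k)^-1%g x) =
  rank_array n (zero_at n D) (k + offset) (rankB x).
Proof.
elim: k x => [|k IH] x km.
  rewrite partial_prod0 invg1 perm1 rank_array_id // => t.
  by rewrite add0n => /zero_at_outside.
rewrite (partial_prodS (Ordinal km)) invMg permM IH ?(ltnW km) //.
rewrite word_factorE addSn /=; congr rank_array.
case: ifP => _; last by rewrite invg1 perm1.
by rewrite /word_refl simpleBV rankB_simpleB word_label.
Qed.

Lemma Gamma_diagram_ordered :
  Gamma_diagram hm D <->
  (forall t, t < 2 * n - 1 ->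
     rank_array n (zero_at n D) t (step_label n t)
       < rank_array n (zero_at n D) t (step_label n t).+1).
Proof.
have step (k : 'I_m) :
    bruhatB_lt (partial_prod hm D k) (partial_prod hm D k * word_refl hm k)%g <->
    rank_array n (zero_at n D) (k + offset) (step_label n (k + offset))
     < rank_array n (zero_at n D) (k + offset) (step_label n (k + offset)).+1.
  have km := ltnW (ltn_ord k); have [r rE] := partial_prod_word km.
  have := bruhatB_ltP r (label (widen_ord hm (rev_ord k) : box n)).
  by rewrite /= -rE !rankB_partial_prod // rankB_low rankB_high word_label.
split=> [G t tn|ord k]; last by apply/step/ord; have := ltn_ord k; lia.
have [/= lt_t|le_t] := ltnP t offset.
  (* Before the shape begins the array is the identity, so nothing can fail. *)
  by rewrite !rank_array_id // => t' lt'; apply: zero_at_outside; lia.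
have km : t - offset < m by lia.
by have /step := G (Ordinal km); rewrite /= subnK.
Qed.

End Diagram.

Theorem mainTheorem7 (n m : nat) (hn : 2 <= n) (hm : m <= 2 * n - 1)
    (D : oplus_diagram m) :
  Gamma_diagram hm D <->
  (forall k l c : 'I_m,
     n < boxnum k -> D k = Zero ->
     boxnum l = boxnum k - 1 -> boxnum c = 2 * n - boxnum k + 1 ->
     ~ (D l = Plus /\ D c = Plus)).
Proof.
rewrite Gamma_diagram_ordered // rank_array_orderedP // /boxnum.
split=> [good k l c nk /is_zeroP zk lE cE|good i lt_in].
  case=> /is_plusP pl /is_plusP pc.
  have km := ltn_ord k; move: (good (2 * n - 2 - k)).
  rewrite (@zero_atE _ _ _ k); try lia.
  rewrite (@zero_atE _ _ _ l (2 * n - 2 - k).+1); try lia.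
  by rewrite (@zero_atE _ _ _ c (2 * n - 3 - (2 * n - 2 - k))); lia.
rewrite {1}/zero_at; case: insubP => // k km kE0 zk pl.
have kE : k = 2 * n - 2 - i :> nat := kE0.
(* A zero lies inside the shape, and the other two boxes have smaller indices, so they do too. *)
have lm : k.-1 < m by lia.
have cm : i.+1 < m by lia.
move: pl; rewrite (@zero_atE _ _ _ (Ordinal lm) i.+1) /=; try lia.
rewrite (@zero_atE _ _ _ (Ordinal cm) (2 * n - 3 - i)) /=; try lia.
move=> /is_plusP pl; apply: contraT => /is_plusP pc.
by case: (good k (Ordinal lm) (Ordinal cm)) => //=; [|apply/is_zeroP| |]; lia.
Qed.
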